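(* Let $n\ge1$ and, for $\lambda\in(0,1)$ and $\kappa\ge2$ an even integer, let $w_{\lambda,\kappa}(x)=(1+|x|^{\kappa})^{-\lambda/\kappa}$ for $x\in\mathbb{R}^n$. Consider the operator $T_{w_{\lambda,\kappa}}f=[\Lambda^{\alpha/2},w_{\lambda,\kappa}]f$. Then: (1) If $\alpha\in(0,1)$, then for all $\lambda$ with $0<\lambda<\alpha/2$ and all even integers $\kappa\ge2$, the operator $T_{w_{\lambda,\kappa}}$ is continuous from $L^2(w_{\lambda,\kappa})$ to $L^2(w_{\lambda,\kappa}^{-1})$; that is, there exists a constant $C>0$ depending on $\alpha,\lambda,\kappa,n$ such that for all $f\in L^2(w_{\lambda,\kappa})$, $$\int_{\mathbb{R}^n}\big|[\Lambda^{\alpha/2},w_{\lambda,\kappa}]f\big|^2\,\frac{dx}{w_{\lambda,\kappa}}\le C\int_{\mathbb{R}^n}|f|^2\,w_{\lambda,\kappa}\,dx.$$ (2) If $1<\alpha<2$, then for all $\lambda\in(0,1)$ and all even integers $\kappa\ge2$, the operator $T_{w_{\lambda,\kappa}}$ is continuous from $L^2(w_{\lambda,\kappa})$ to $L^2(w_{\lambda,\kappa}^{-1})$.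
   Context: For a positive weight $w$ on $\mathbb{R}^n$, $L^2(w)$ is the space of measurable $f$ with $\|f\|_{L^2(w)}^2=\int_{\mathbb{R}^n}|f|^2w\,dx<\infty$. For $0<s<2$, $\Lambda^{s}f(x)=(-\Delta)^{s/2}f(x)=C(s,n)\,\mathrm{P.V.}\int_{\mathbb{R}^n}\frac{f(x)-f(y)}{|x-y|^{n+s}}\,dy$ with normalizing constant $C(s,n)>0$. The commutator is $[\Lambda^{\alpha/2},w]f=\Lambda^{\alpha/2}(wf)-w\Lambda^{\alpha/2}f$, i.e. $$[\Lambda^{\alpha/2},w]f(x)=C(\alpha/2,n)\,\mathrm{P.V.}\int_{\mathbb{R}^n}\frac{w(x)-w(y)}{|x-y|^{n+\alpha/2}}\,f(y)\,dy.$$ *)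

(* Defs.v *)
From HB Require Import structures.
From mathcomp Require Import all_boot all_order all_algebra.
From mathcomp Require Import all_classical all_reals all_analysis.
From mathcomp Require Import measurable_realfun ring.

Set Implicit Arguments.
Unset Strict Implicit.
Unset Printing Implicit Defensive.
Import Order.TTheory GRing.Theory Num.Theory.
Import numFieldNormedType.Exports.
Local Open Scope classical_set_scope.
Local Open Scope ring_scope.

(* The carrier of R^n, with the Borel (= product) sigma-algebra that the
   library puts on tuples. *)
Notation Rn R n := (n.-tuple (measurableTypeR R)).

(* The library proves this as well, but does not make it canonical for measures
   that are not subprobabilities. *)
Lemma sigma_finite_prod d1 d2 (T1 : measurableType d1) (T2 : measurableType d2)
    (R : realType) (m1 : {sigma_finite_measure set T1 -> \bar R})
    (m2 : {sigma_finite_measure set T2 -> \bar R}) :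
  sigma_finite setT (m1 \x m2)%E.
Proof.
have /sigma_finiteP[F [TF ndF Foo]] := sigma_finiteT m1.
have /sigma_finiteP[G [TG ndG Goo]] := sigma_finiteT m2.
exists (fun n => F n `*` G n).
  rewrite -setXTT TF TG predeqE => -[x y]; split.
    move=> [/= [n _ Fnx] [k _ Gky]]; exists (maxn n k) => //; split.
    - by move: x Fnx; exact/subsetPset/ndF/leq_maxl.
    - by move: y Gky; exact/subsetPset/ndG/leq_maxr.
  by move=> [n _ []/= ? ?]; split; exists n.
move=> k; have [? ?] := Foo k; have [? ?] := Goo k.
split; first exact: measurableX.
by rewrite product_measure1E// lte_mul_pinfty// ge0_fin_numE.
Qed.

Section lebesgue_measure_Rn.
Context (R : realType).

Definition consRn n (p : measurableTypeR R * Rn R n) : Rn R n.+1 :=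
  [the n.+1.-tuple _ of p.1 :: p.2].

Lemma measurable_consRn n : measurable_fun [set: _] (@consRn n).
Proof. by apply: measurable_cons; [exact: measurable_fst|exact: measurable_snd]. Qed.

Section succ.
Context (n : nat) (mu : {sigma_finite_measure set (Rn R n) -> \bar R}).

Definition lebesgueRn_succ : set (Rn R n.+1) -> \bar R :=
  pushforward (@lebesgue_measure R \x mu)%E (@consRn n).

Let lebesgueRn_succ0 : lebesgueRn_succ set0 = 0%E.
Proof. by rewrite /lebesgueRn_succ measure0//; exact: measurable_consRn. Qed.

Let lebesgueRn_succ_ge0 A : (0 <= lebesgueRn_succ A)%E.
Proof. by rewrite /lebesgueRn_succ /pushforward; exact: measure_ge0. Qed.

Let lebesgueRn_succ_sigma_additive : semi_sigma_additive lebesgueRn_succ.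
Proof.
by apply: (@measure_semi_sigma_additive _ _ _
  (pushforward (@lebesgue_measure R \x mu)%E (@consRn n)));
  exact: measurable_consRn.
Qed.

HB.instance Definition _ := isMeasure.Build _ _ _ lebesgueRn_succ
  lebesgueRn_succ0 lebesgueRn_succ_ge0 lebesgueRn_succ_sigma_additive.

Let lebesgueRn_succ_sigma_finite : sigma_finite setT lebesgueRn_succ.
Proof.
have [F FT mF] := sigma_finite_prod (@lebesgue_measure R) mu.
pose g (t : Rn R n.+1) : measurableTypeR R * Rn R n :=
  (tnth t ord0, [tuple of behead t]).
have mg : measurable_fun setT g.
  by apply: measurable_fun_pair; [exact: measurable_tnth|exact: measurable_behead].
have gK : cancel g (@consRn n).
  by move=> t; apply/val_inj => /=; rewrite [in RHS](tuple_eta t).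
have Kg : cancel (@consRn n) g.
  by move=> [a t]; congr pair; apply/val_inj.
exists (fun i => g @^-1` F i); first by rewrite -preimage_bigcup -FT.
move=> i; split; first by rewrite -[X in measurable X]setTI; apply: mg; have [] := mF i.
rewrite /lebesgueRn_succ /pushforward -comp_preimage.
rewrite (_ : g \o _ = id) ?preimage_id; first by have [] := mF i.
by apply/funext => x; exact: Kg.
Qed.

HB.instance Definition _ := Measure_isSigmaFinite.Build _ _ _ lebesgueRn_succ
  lebesgueRn_succ_sigma_finite.

End succ.

(* n-dimensional Lebesgue measure: the image of the n-fold product of the
   one-dimensional one under the identification of R * R^n with R^(n+1). *)
Fixpoint lebesgueRn n : {sigma_finite_measure set (Rn R n) -> \bar R} :=
  if n is m.+1 then lebesgueRn_succ (lebesgueRn m)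
  else @dirac _ (Rn R 0) [tuple] R.

End lebesgue_measure_Rn.

(* Integration is only ever applied below to functions that agree almost
   everywhere with a Borel function; on these the integral of the library,
   although it is defined with Borel simple functions, is the integral for the
   completed measure, by the following invariance. *)
Section ae_integral.
Local Open Scope ereal_scope.
Context d (T : measurableType d) (R : realType).
Variable mu : {measure set T -> \bar R}.
Import HBNNSimple.

Lemma le_nnintegral_ae (f g : T -> \bar R) :
  (forall x, 0 <= f x) -> (forall x, 0 <= g x) ->
  {ae mu, forall x, f x = g x} -> \int[mu]_x f x <= \int[mu]_x g x.
Proof.
move=> f0 g0 [N [mN N0 fgN]].
rewrite ge0_integralTE//; apply: ge_ereal_sup => _ [h hf <-].
rewrite -integralT_nnsfun.
rewrite [leLHS](_ : _ = \int[mu]_x (EFin \o (h \* \1_(~` N))%R) x); last first.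
  apply: ae_eq_integral => //; first exact/measurable_EFinP.
    by apply/measurable_EFinP; apply: measurable_funM => //;
      exact/measurable_indic/measurableC.
  exists N; split => //= x /= /not_implyP[_] hN.
  apply: contrapT => xN; apply: hN; rewrite indicE.
  by rewrite mem_set ?mulr1.
rewrite [leRHS]ge0_integralTE//.
pose h' := mul_nnsfun h (indic_nnsfun R (measurableC mN)).
have -> : \int[mu]_x (EFin \o (h \* \1_(~` N))%R) x = sintegral mu h'.
  by rewrite -integralT_nnsfun; apply: eq_integral.
apply: ereal_sup_ubound; exists h' => //= x.
rewrite [X in X%:E <= _](_ : _ = (h x * \1_(~` N) x)%R) // indicE.
have [xN|xN] := boolP (x \in ~` N); last by rewrite mulr0.
rewrite mulr1; apply: (le_trans (hf x)).
move: xN; rewrite inE => xN; rewrite le_eqVlt; apply/orP; left; apply/eqP.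
by apply: contrapT => fg; apply: xN; exact: fgN.
Qed.

Lemma ae_integral (D : set T) (f g : T -> \bar R) :
  {ae mu, forall x, D x -> f x = g x} ->
  \int[mu]_(x in D) f x = \int[mu]_(x in D) g x.
Proof.
move=> fg; rewrite integral_mkcond [RHS]integral_mkcond.
have {fg} : {ae mu, forall x, (f \_ D) x = (g \_ D) x}.
  apply: filterS fg => x fg; rewrite /patch; case: ifPn => //.
  by rewrite inE => /fg.
move: (f \_ D) (g \_ D) => {}f {}g fg.
have gf : {ae mu, forall x, g x = f x} by apply: filterS fg => x ->.
rewrite integralE [RHS]integralE; congr (_ - _); apply/eqP; rewrite eq_le;
  apply/andP; split; apply: le_nnintegral_ae => //.
all: try by apply: filterS fg => x fgx; rewrite ?funeposE ?funenegE fgx.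
all: by apply: filterS gf => x fgx; rewrite ?funeposE ?funenegE fgx.
Qed.

End ae_integral.

Section L2_and_commutator.
Context (R : realType) (n : nat).
Implicit Types (f w : Rn R n -> R) (x y : Rn R n).

Definition Rnorm x : R := Num.sqrt (\sum_(i < n) tnth x i ^+ 2).

Definition Rdist x y : R := Num.sqrt (\sum_(i < n) (tnth x i - tnth y i) ^+ 2).

Definition far x (e : R) : set (Rn R n) := [set y | e < Rdist x y].

(* A function is Lebesgue measurable iff it is almost everywhere equal to a
   Borel function. *)
Definition Lebesgue_measurable f :=
  exists2 g : Rn R n -> R,
    measurable_fun setT g & {ae lebesgueRn R n, forall x, f x = g x}.

Definition L2sqnorm w f : \bar R :=
  (\int[lebesgueRn R n]_x (`|f x| ^+ 2 * w x)%:E)%E.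

Definition in_L2 w f := Lebesgue_measurable f /\ (L2sqnorm w f < +oo)%E.

(* Truncations of the singular integral of k at x; pv below is meaningful under
   pv_exists: each truncation is absolutely convergent and the truncations have
   a finite limit. *)
Definition pv_trunc (k : Rn R n -> R) x (e : R) : R :=
  \int[lebesgueRn R n]_(y in far x e) k y.

Definition pv_exists (k : Rn R n -> R) x :=
  (forall e : R, 0 < e ->
    (\int[lebesgueRn R n]_(y in far x e) `|(k y)%:E| < +oo)%E) /\
  cvg (pv_trunc k x e @[e --> 0^'+]).

Definition pv (k : Rn R n -> R) x : R := lim (pv_trunc k x e @[e --> 0^'+]).

(* C(s, n), in the form which makes |xi|^s the symbol of (-Delta)^(s/2); z`_0 is
   the first coordinate of z. *)
Definition frac_const (s : R) : R :=
  (\int[lebesgueRn R n]_z ((1 - cos (z`_0)%R) / Rnorm z `^ (n%:R + s)))^-1.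

Definition frac_laplacian_kernel (s : R) f x y : R :=
  (f x - f y) / Rdist x y `^ (n%:R + s).

Definition frac_laplacian (s : R) f x : R :=
  frac_const s * pv (frac_laplacian_kernel s f x) x.

Definition commutator_kernel (s : R) w f x y : R :=
  (w x - w y) / Rdist x y `^ (n%:R + s) * f y.

(* The commutator of (-Delta)^(s/2) and w, as a singular integral: for general
   f in L^2(w) the two terms of the commutator have no pointwise meaning on
   their own. *)
Definition commutator (s : R) w f x : R :=
  frac_const s * pv (commutator_kernel s w f x) x.

Definition commutator_exists (s : R) w f x := pv_exists (commutator_kernel s w f x) x.

(* T, with value at x meaningful when dom f x, is a bounded operator from L^2(v)
   to L^2(v'). *)
Definition L2_bounded (dom : (Rn R n -> R) -> Rn R n -> Prop)
    (T : (Rn R n -> R) -> Rn R n -> R) (v v' : Rn R n -> R) :=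
  exists2 C : R, 0 < C &
    forall f, in_L2 v f ->
      [/\ {ae lebesgueRn R n, forall x, dom f x},
          in_L2 v' (T f) &
          (L2sqnorm v' (T f) <= C%:E * L2sqnorm v f)%E].

Definition weight (lambda : R) (kappa : nat) x : R :=
  (1 + Rnorm x ^+ kappa) `^ (- (lambda / kappa%:R)).

Lemma measurable_Rdist x : measurable_fun setT (Rdist x).
Proof.
apply: (@measurableT_comp _ _ _ _ _ _ (@Num.sqrt R) _
    (fun y => \sum_(i < n) (tnth x i - tnth y i) ^+ 2)).
  apply: continuous_measurable_fun; exact: sqrt_continuous.
apply: measurable_sum => i; apply: measurable_funX.
by apply: measurable_funB => //; exact: measurable_tnth.
Qed.

(* On functions for which both terms make sense, this is indeed the commutator. *)
Lemma commutatorE (s : R) w f x :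
    measurable_fun setT w -> measurable_fun setT f ->
    pv_exists (frac_laplacian_kernel s (w \* f) x) x ->
    pv_exists (frac_laplacian_kernel s f x) x ->
  commutator_exists s w f x /\
  commutator s w f x = frac_laplacian s (w \* f) x - w x * frac_laplacian s f x.
Proof.
move=> mw mf [fin1 cv1] [fin2 cv2].
pose k1 := frac_laplacian_kernel s (w \* f) x.
pose k2 := frac_laplacian_kernel s f x.
have mD e : measurable (far x e).
  rewrite (_ : far x e = Rdist x @^-1` `]e, +oo[).
    by rewrite -[X in measurable X]setTI; exact: measurable_Rdist.
  by apply/seteqP; split => y /=; rewrite in_itv/= andbT.
have mk g : measurable_fun setT g -> measurable_fun setT (frac_laplacian_kernel s g x).
  move=> mg; apply: measurable_funM; first exact: measurable_funB.
  under eq_fun do rewrite -powRN.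
  apply: (@measurableT_comp _ _ _ _ _ _ (fun r : R => r `^ (- (n%:R + s))) _
      (Rdist x)).
    exact: measurable_powR.
  exact: measurable_Rdist.
have intk1 e : 0 < e -> (lebesgueRn R n).-integrable (far x e) (EFin \o k1).
  move=> e0; apply/integrableP; split; last exact: fin1.
  apply/measurable_EFinP; apply: measurable_funTS; apply: mk.
  exact: measurable_funM.
have intk2 e : 0 < e -> (lebesgueRn R n).-integrable (far x e) (EFin \o k2).
  move=> e0; apply/integrableP; split; last exact: fin2.
  by apply/measurable_EFinP; apply: measurable_funTS; exact: mk.
have kE : commutator_kernel s w f x = (fun y => k1 y - w x * k2 y).
  apply/funext => y; rewrite /k1 /k2 /commutator_kernel /frac_laplacian_kernel /=.
  by ring.
have intwk2 e : 0 < e ->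
    (lebesgueRn R n).-integrable (far x e) (EFin \o (fun y => w x * k2 y)).
  move=> e0; rewrite (_ : _ \o _ = fun y => (w x)%:E * (EFin \o k2) y)%E //.
  by apply: integrableZl => //; exact: intk2.
have truncE e : 0 < e -> pv_trunc (commutator_kernel s w f x) x e =
    pv_trunc k1 x e - w x * pv_trunc k2 x e.
  move=> e0; rewrite /pv_trunc kE RintegralB//; [|exact: intk1|exact: intwk2].
  by rewrite RintegralZl//; exact: intk2.
have cvE : pv_trunc (commutator_kernel s w f x) x e @[e --> 0^'+] -->
    pv k1 x - w x * pv k2 x.
  have l1 : pv_trunc k1 x e @[e --> 0^'+] --> pv k1 x by [].
  have l2 : pv_trunc k2 x e @[e --> 0^'+] --> pv k2 x by [].
  have l12 := cvgB l1 (cvgM (cvg_cst (w x)) l2).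
  apply: cvg_trans (l12 _ _ _); apply: near_eq_cvg; near=> e.
  by rewrite truncE //; near: e; exact: nbhs_right_gt.
split; last first.
  rewrite /commutator /frac_laplacian.
  rewrite {1}/pv (cvg_lim _ cvE)// mulrBr; congr (_ - _).
  by rewrite mulrCA.
split; last by apply/cvg_ex; eexists; exact: cvE.
move=> e e0; have := integrableB (mD e) (intk1 _ e0) (intwk2 _ e0).
by move=> /integrableP[_]; rewrite kE.
Unshelve. all: by end_near.
Qed.

End L2_and_commutator.

(* Main.v *)
Require Import Defs.
From mathcomp Require Import all_boot all_order all_algebra.
From mathcomp Require Import all_classical all_reals all_analysis.
From mathcomp Require Import measurable_realfun ring lra.
Import Order.TTheory GRing.Theory Num.Theory.
Import numFieldNormedType.Exports.
Local Open Scope classical_set_scope.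
Local Open Scope ring_scope.

(** Write [s] for half of [alpha], [d] for the distance [Rdist x y], and [w] for
    the weight. The commutator is the integral operator with kernel
    [(w x - w y) / d ^ (n + s)]. Conjugating it by the square root of [w] turns
    boundedness from L^2(w) to L^2(1/w) into boundedness on the unweighted L^2
    of the kernel
      [(w x - w y) / (sqrt (w x) * sqrt (w y) * d ^ (n + s))],
    which is bounded by an integrable function of [d] alone; Schur's test then
    concludes. Both cases of the theorem are instances of the single condition
    [0 < s < 1], [0 <= lambda < 2 s].

    The bound on the kernel comes from the slow variation of the weight:
    [w x <= (1 + d) ^ lambda * w y] ([weight_ratio]), which is the triangle
    inequality followed by a comparison of binomial expansions. For
    [t = sqrt (w x / w y)], taken to be at least 1 by symmetry, the conjugated
    numerator is [t - 1 / t] with [t <= (1 + d) ^ (lambda / 2)]. Hence it is at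
    most [2 d] for [d <= 1] and [2 d ^ (lambda / 2)] for [d >= 1]
    ([slowly_varying_diff_le]). So the kernel is at most [2 d ^ (1 - n - s)] near the
    diagonal and [2 d ^ (lambda / 2 - n - s)] far from it: integrable near the
    diagonal because [s < 1], and at infinity because [lambda / 2 < s].

    Since a cube of radius [r] has measure [(2 r) ^ n] ([lebesgueRn_cube]), the
    integrals of these powers over dyadic annuli are dominated by the terms of a
    geometric series ([integral_annuli_le]), so no polar coordinates occur.

    The same majorant shows that, for almost every [x], the singular integral
    converges absolutely. Dominated convergence then identifies its principal
    value with an ordinary integral ([pv_integrable]), whose measurability and
    size are obtained from Tonelli's theorem and [schur_test]. *)

(** * Euclidean distance *)

Section Euclidean.
Context {R : realType} {n : nat}.
Implicit Types x y : Rn R n.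

Lemma Rnorm_ge0 x : 0 <= Rnorm x. Proof. exact: sqrtr_ge0. Qed.

Lemma Rdist_ge0 x y : 0 <= Rdist x y. Proof. exact: sqrtr_ge0. Qed.

Lemma RdistC x y : Rdist x y = Rdist y x.
Proof. by congr Num.sqrt; apply: eq_bigr => i _; rewrite -sqrrN opprB. Qed.

Lemma le_tnth_Rdist x y i : `|tnth x i - tnth y i| <= Rdist x y.
Proof.
rewrite -sqrtr_sqr ler_sqrt ?sqr_ge0//; last first.
  by apply: sumr_ge0 => j _; exact: sqr_ge0.
by rewrite (bigD1 i)//= lerDl sumr_ge0// => j _; exact: sqr_ge0.
Qed.

Lemma Rdist_eq0 x y : Rdist x y = 0 -> x = y.
Proof.
move=> d0; apply: eq_from_tnth => i; apply/eqP; rewrite -subr_eq0 -normr_le0 -d0.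
exact: le_tnth_Rdist.
Qed.

(** The Cauchy-Schwarz inequality for finite sums, with the two norms given as
    square roots [A] and [B] of the sums of squares. *)
Lemma sum_mul_le (I : finType) (a b : I -> R) (A B : R) :
    0 <= A -> 0 <= B -> \sum_i a i ^+ 2 = A ^+ 2 -> \sum_i b i ^+ 2 = B ^+ 2 ->
  \sum_i a i * b i <= A * B.
Proof.
move=> A0 B0 aA bB.
have vanish (c : I -> R) : \sum_i c i ^+ 2 = 0 -> forall i, c i = 0.
  move=> /eqP; rewrite psumr_eq0; last by move=> i _; exact: sqr_ge0.
  by move=> /allP c0 i; have := c0 i (mem_index_enum i); rewrite /= sqrf_eq0 => /eqP.
have [A00|A00] := eqVneq A 0.
  rewrite big1 ?mulr_ge0// => i _; rewrite (vanish a) ?mul0r//.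
  by rewrite aA A00 expr0n.
have [B00|B00] := eqVneq B 0.
  rewrite big1 ?mulr_ge0// => i _; rewrite (vanish b) ?mulr0//.
  by rewrite bB B00 expr0n.
have {}A0 : 0 < A by rewrite lt0r A00.
have {}B0 : 0 < B by rewrite lt0r B00.
(* Termwise [2 (A B) (a b) <= (B a)^2 + (A b)^2]; the right-hand sides add up
   to [2 (A B)^2]. *)
rewrite -(ler_pM2l (mulr_gt0 A0 B0)) -(ler_pM2l (ltr0Sn _ 1)) !mulr_sumr.
rewrite [leRHS](_ : _ = \sum_i (B ^+ 2 * a i ^+ 2 + A ^+ 2 * b i ^+ 2)); last first.
  by rewrite big_split/= -!mulr_sumr aA bB; ring.
apply: ler_sum => i _; rewrite -subr_ge0.
by rewrite (_ : _ - _ = (B * a i - A * b i) ^+ 2) ?sqr_ge0//; ring.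
Qed.

Lemma Rnorm_le_Rdist x y : Rnorm y <= Rnorm x + Rdist x y.
Proof.
have sqS (c : 'I_n -> R) : Num.sqrt (\sum_i c i ^+ 2) ^+ 2 = \sum_i c i ^+ 2.
  by rewrite sqr_sqrtr// sumr_ge0// => i _; exact: sqr_ge0.
have d0 := Rdist_ge0 x y; have x0 := Rnorm_ge0 x.
rewrite -(@ler_pXn2r _ 2)// ?nnegrE ?Rnorm_ge0 ?addr_ge0//.
have h := sum_mul_le _ (fun i => tnth x i) (fun i => tnth y i - tnth x i) _ _ x0 d0.
have {}h := h (esym (sqS _)).
rewrite sqS sqrrD !sqS.
rewrite (_ : \sum_i tnth y i ^+ 2 = \sum_i tnth x i ^+ 2 +
    (\sum_i tnth x i * (tnth y i - tnth x i)) *+ 2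
    + \sum_i (tnth x i - tnth y i) ^+ 2); last first.
  by rewrite -sumrMnl -!big_split/=; apply: eq_bigr => i _; ring.
rewrite lerD2r lerD2l lerMn2r/= h//.
by rewrite RdistC /Rdist sqS.
Qed.

Lemma measurable_sqrt : measurable_fun setT (@Num.sqrt R).
Proof. by apply: continuous_measurable_fun; exact: sqrt_continuous. Qed.

Lemma measurable_Rnorm : measurable_fun setT (@Rnorm R n).
Proof.
apply: (@measurableT_comp _ _ _ _ _ _ (@Num.sqrt R) _
    (fun x : Rn R n => \sum_(i < n) tnth x i ^+ 2)).
  exact: measurable_sqrt.
by apply: measurable_sum => i; apply: measurable_funX; exact: measurable_tnth.
Qed.

Lemma measurable_Rdist2 :
  measurable_fun setT (fun xy : Rn R n * Rn R n => Rdist xy.1 xy.2).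
Proof.
apply: (@measurableT_comp _ _ _ _ _ _ (@Num.sqrt R) _
    (fun xy : Rn R n * Rn R n => \sum_(i < n) (tnth xy.1 i - tnth xy.2 i) ^+ 2)).
  exact: measurable_sqrt.
apply: measurable_sum => i; apply: measurable_funX; apply: measurable_funB.
  by apply: (measurableT_comp (measurable_tnth i)); exact: measurable_fst.
by apply: (measurableT_comp (measurable_tnth i)); exact: measurable_snd.
Qed.

End Euclidean.

(** * Slow variation of the weight *)

Section weight.
Context {R : realType}.

(** Compare the binomial expansions of [(a + d) ^ k] and [(1 + d) ^ k]
    coefficient by coefficient: [a ^ (k - j) <= 1 + a ^ k], by cases on whether
    [a <= 1]; the constant term 1 on the left fits into the term [j = 0]. *)
Lemma one_plus_pow_le (a b d : R) k : 0 <= a -> 0 <= d -> 0 <= b <= a + d ->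
  1 + b ^+ k <= (1 + d) ^+ k * (1 + a ^+ k).
Proof.
move=> a0 d0 /andP[b0 bad].
apply: (@le_trans _ _ (1 + (a + d) ^+ k)).
  by rewrite lerD2l lerXn2r// ?nnegrE ?addr_ge0.
rewrite !exprDn mulr_suml !big_ord_recl/= !subn0 !expr0 !mulr1 expr1n bin0.
rewrite mul1r addrA lerD2l; apply: ler_sum => i _.
rewrite expr1n mul1r mulrnAl lerMn2r; apply/orP; right.
rewrite mulrC; apply: ler_wpM2l; first exact: exprn_ge0.
have [a1|a1] := leP a 1.
  rewrite (le_trans (exprn_ile1 _ a0 a1))// lerDl exprn_ge0//.
by rewrite (le_trans (ler_weXn2l (ltW a1) (leq_subr (bump 0 i) k)))// lerDr.
Qed.

Context {n : nat}.
Implicit Types x y : Rn R n.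

Lemma weight_gt0 lam k x : 0 < weight lam k x.
Proof. by apply: powR_gt0; rewrite ltr_pwDl// exprn_ge0// Rnorm_ge0. Qed.

(** The exponents cancel: raising [(1 + d) ^ k] to the power [lam / k] leaves
    [(1 + d) ^ lam], independently of [k]. *)
Lemma weight_ratio lam k x y : 0 <= lam -> (0 < k)%N ->
  weight lam k x <= (1 + Rdist x y) `^ lam * weight lam k y.
Proof.
move=> lam0 k0; rewrite /weight !powRN.
have d0 := Rdist_ge0 x y.
have u0 z : 0 < 1 + Rnorm z ^+ k by rewrite ltr_pwDl// exprn_ge0// Rnorm_ge0.
rewrite ler_pdivlMr ?powR_gt0// mulrC ler_pdivrMr ?powR_gt0//.
rewrite (_ : (1 + Rdist x y) `^ lam =
    ((1 + Rdist x y) ^+ k) `^ (lam / k%:R)); last first.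
  rewrite -powR_mulrn ?addr_ge0// -powRrM mulrCA divff ?mulr1//.
  by rewrite pnatr_eq0 -lt0n.
rewrite -powRM ?exprn_ge0 ?addr_ge0 ?exprn_ge0 ?Rnorm_ge0//.
apply: ge0_ler_powR; rewrite ?nnegrE ?divr_ge0 ?mulr_ge0 ?exprn_ge0 ?addr_ge0
  ?exprn_ge0 ?Rnorm_ge0//.
by apply: one_plus_pow_le; rewrite ?Rnorm_ge0// Rnorm_le_Rdist.
Qed.

(** A bound on [(w x - w y) / (sqrt (w x) * sqrt (w y))] at distance [d]: linear
    near 0, which is what beats the singularity of the kernel, and of the growth
    of [sqrt (w x / w y)] at infinity. *)
Definition dist_modulus (lam d : R) : R :=
  if d <= 1 then 2 * d else 2 * d `^ (lam / 2).

(** In terms of [t = p / q] this is [t ^ 2 - 1 <= t * dist_modulus lam d] for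
    [1 <= t <= (1 + d) ^ (lam / 2)]. For [d <= 1] the exponent may be replaced by
    1, and [t ^ 2 - 1 - 2 d t] is convex and nonpositive at both ends of
    [[1, 1 + d]]. For [d >= 1] it suffices that
    [t <= (2 d) ^ (lam / 2) <= 2 d ^ (lam / 2)]. *)
Lemma diff_sqr_le (lam d p q : R) : 0 <= lam <= 2 -> 0 <= d -> 0 < q -> q <= p ->
  p <= (1 + d) `^ (lam / 2) * q -> p ^+ 2 - q ^+ 2 <= p * q * dist_modulus lam d.
Proof.
move=> /andP[lam0 lam2] d0 q0 qp; rewrite -ler_pdivrMr// /dist_modulus.
have -> : p = (p / q) * q by rewrite divfK// gt_eqF.
have : 1 <= p / q by rewrite ler_pdivlMr// mul1r.
move: (p / q) => t t1; rewrite mulfK ?gt_eqF// => tle.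
have q20 : 0 < q * q by rewrite mulr_gt0.
rewrite (_ : _ - _ = (q * q) * (t ^+ 2 - 1)); last by ring.
rewrite [leRHS](_ : _ =
  (q * q) * (t * (if d <= 1 then 2 * d else 2 * d `^ (lam / 2)))); last by ring.
rewrite ler_pM2l//.
case: ifPn => [d1|]; [|rewrite -ltNge => d1].
  have {}tle : t <= 1 + d.
    rewrite (le_trans tle)// -[leRHS]powRr1 ?addr_ge0//.
    by apply: ler_powR; [rewrite lerDl|lra].
  have h1 : 0 <= (t - 1) * (1 + d - t) by rewrite mulr_ge0// subr_ge0.
  have h2 : 0 <= d * (t - 1) by rewrite mulr_ge0// subr_ge0.
  by rewrite -subr_ge0; nra.
have {}tle : t <= 2 * d `^ (lam / 2).
  rewrite (le_trans tle)//; apply: (@le_trans _ _ ((2 * d) `^ (lam / 2))).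
    apply: ge0_ler_powR; rewrite ?nnegrE; lra.
  rewrite powRM ?ler0n//; apply: ler_wpM2r; first exact: powR_ge0.
  rewrite -[leRHS]powRr1 ?ler0n//; apply: ler_powR; lra.
by rewrite (@le_trans _ _ (t * t))//; [nra|rewrite ler_pM2l//; lra].
Qed.

(** After exchanging [x] and [y] if [w x < w y], the ratio bound on [w] says that
    [p = sqrt (w x)] and [q = sqrt (w y)] satisfy the hypothesis of
    [diff_sqr_le]. *)
Lemma slowly_varying_diff_le (w : Rn R n -> R) lam : 0 <= lam <= 2 ->
    (forall x, 0 < w x) ->
    (forall x y, w x <= (1 + Rdist x y) `^ lam * w y) ->
  forall x y, `|w x - w y| <=
    Num.sqrt (w x) * Num.sqrt (w y) * dist_modulus lam (Rdist x y).
Proof.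
move=> lam02 w0 wslow x y.
wlog wyx : x y / w y <= w x.
  move=> wl; have [/wl//|/ltW /wl] := leP (w y) (w x).
  by rewrite distrC [Num.sqrt _ * _]mulrC RdistC.
rewrite ger0_norm ?subr_ge0//.
have sqrK z : w z = Num.sqrt (w z) ^+ 2 by rewrite sqr_sqrtr// ltW.
rewrite {1}[w x]sqrK {1}[w y]sqrK.
apply: diff_sqr_le => //; rewrite ?Rdist_ge0 ?sqrtr_gt0//.
  by rewrite ler_sqrt// ltW.
rewrite powRrM powR12_sqrt ?powR_ge0// -sqrtrM ?powR_ge0//.
by rewrite ler_sqrt ?wslow// mulr_ge0 ?powR_ge0// ltW.
Qed.

Lemma measurable_weight (lam : R) (k : nat) :
  measurable_fun setT (weight lam k : Rn R n -> R).
Proof.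
apply: (@measurableT_comp _ _ _ _ _ _ (fun r : R => r `^ (- (lam / k%:R))) _
  (fun x : Rn R n => 1 + Rnorm x ^+ k)); first exact: measurable_powR.
by apply: measurable_funD => //; apply: measurable_funX; exact: measurable_Rnorm.
Qed.

End weight.

(** * Integrals of powers of the distance *)

Section radial.
Context {R : realType}.

Lemma ge0_nneseries_ge (u : nat -> \bar R) k : (forall i, 0 <= u i)%E ->
  (u k <= \sum_(0 <= i <oo) u i)%E.
Proof.
move=> u0; rewrite (nneseries_split 0 k.+1)//.
rewrite add0n big_nat_recr//= -addeA [leRHS]addeCA leeDl//.
by rewrite adde_ge0 ?sume_ge0// nneseries_ge0.
Qed.

Lemma nneseries_geometric (a q : R) : 0 <= a -> 0 <= q < 1 ->
  (\sum_(0 <= k <oo) (a * q ^+ k)%:E = (a / (1 - q))%:E)%E.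
Proof.
move=> a0 /andP[q0 q1]; apply/cvg_lim => //.
have := @cvg_geometric_series R a q; rewrite ger0_norm// => /(_ q1) h.
rewrite (_ : (fun m => _) = EFin \o series (geometric a q)); last first.
  by apply/funext => m /=; rewrite sumEFin.
by apply: cvg_EFin => //; exact: nearW.
Qed.

Lemma dyadic_le1 (d : R) : 0 < d <= 1 ->
  exists k, (2^-1) ^+ k <= d <= 2 * (2^-1) ^+ k.
Proof.
move=> /andP[d0 d1].
have ex : exists k, (2^-1) ^+ k <= d.
  exists (Num.Def.archi_bound d^-1); rewrite exprVn -[leRHS]invrK.
  rewrite lef_pV2 ?posrE ?exprn_gt0 ?invr_gt0//; apply/ltW.
  exact: upper_nthrootP.
case: (ex_minnP ex) => -[|k] kd kmin.
  by exists 0%N; rewrite kd expr0 mulr1; lra.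
exists k.+1; rewrite kd/= exprS mulrA divff ?mul1r//.
by rewrite leNgt; apply/negP => /ltW /kmin; rewrite ltnn.
Qed.

Lemma dyadic_ge1 (d : R) : 1 <= d ->
  exists k, 2 ^+ k <= d <= 2 * 2 ^+ k.
Proof.
move=> d1.
have ex : exists k, d <= 2 ^+ k.+1.
  exists (Num.Def.archi_bound d); apply/ltW/upper_nthrootP.
  exact: leqnSn.
case: (ex_minnP ex) => k kd kmin.
exists k; rewrite -exprS kd andbT.
case: k kd kmin => [|k] kd kmin; first by rewrite expr0.
by rewrite leNgt; apply/negP => /ltW /kmin; rewrite ltnn.
Qed.

Definition cube {n} (x : Rn R n) (r : R) : set (Rn R n) :=
  [set y | forall i, `|tnth x i - tnth y i| <= r].

Lemma measurable_cube {n} (x : Rn R n) r : measurable (cube x r).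
Proof.
rewrite (_ : cube x r = \bigcap_(i in [set: 'I_n])
    ((fun y : Rn R n => tnth y i) @^-1` `[tnth x i - r, tnth x i + r])).
  apply: fin_bigcap_measurable => [|i _]; first exact: finite_finset.
  by rewrite -[X in measurable X]setTI; exact: measurable_tnth.
apply/seteqP; split => y /= h i => [_|]; have := h i.
  by rewrite /= in_itv/= distrC ler_distl.
by rewrite /= in_itv/= distrC ler_distl => /(_ I).
Qed.

Lemma lebesgueRn_cube n (x : Rn R n) r : 0 < r ->
  lebesgueRn R n (cube x r) = ((2 * r) ^+ n)%:E.
Proof.
move=> r0; elim: n x => [|n IH] x.
  by rewrite /= diracE mem_set ?expr0// => -[].
have behE (i : 'I_n) : tnth [tuple of behead x] i = tnth x (lift ord0 i).
  by rewrite tnth_behead; congr tnth; apply: val_inj; rewrite /= inordK// ltnS.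
have consE (p : measurableTypeR R * Rn R n) i :
    tnth (consRn p) (lift ord0 i) = tnth p.2 i.
  by rewrite !(tnth_nth 0).
rewrite /= /lebesgueRn_succ /pushforward.
rewrite (_ : _ @^-1` _ = `[tnth x ord0 - r, tnth x ord0 + r] `*`
    cube [tuple of behead x] r); last first.
  apply/seteqP; split => -[a y] /= h.
    split.
      by have := h ord0; rewrite in_itv/= distrC ler_distl.
    move=> i; have := h (lift ord0 i).
    by rewrite behE consE.
  case: h; rewrite in_itv/= => h0 h i.
  case: (unliftP ord0 i) => [j|] ->; last by rewrite distrC ler_distl.
  have := h j.
  by rewrite behE consE.
rewrite product_measure1E//; last exact: measurable_cube.
rewrite IH exprS EFinM; congr (_ * _)%E.
apply: etrans (lebesgue_measure_itv _) _; rewrite /= lte_fin.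
rewrite ifT; last by lra.
by rewrite -EFinB; congr EFin; ring.
Qed.

Context {n : nat}.
Implicit Types x y : Rn R n.

(** On the annulus [r ^ k <= d <= 2 r ^ k], which lies in a cube of measure
    [(4 r ^ k) ^ n], the function is at most [(r ^ k) ^ (- (n + b))]; the product
    of the two is [4 ^ n * (r ^ - b) ^ k], the general term of a geometric
    series. The ratio [r] is left free so that one statement serves for annuli
    shrinking to the centre ([r = 1 / 2], [b < 0]) and for those going to infinity
    ([r = 2], [b > 0]). *)
Lemma integral_annuli_le x (r b : R) (F : Rn R n -> R) :
    0 < r -> 0 <= n%:R + b -> r `^ (- b) < 1 ->
    measurable_fun setT F -> (forall y, 0 <= F y) ->
    (forall y, F y != 0 -> F y <= Rdist x y `^ (- (n%:R + b)) /\
       exists k, r ^+ k <= Rdist x y <= 2 * r ^+ k) ->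
  (\int[lebesgueRn R n]_y (F y)%:E <= (4 ^+ n / (1 - r `^ (- b)))%:E)%E.
Proof.
move=> r0 nb0 rb1 mF F0 Fle.
pose c k := (r ^+ k) `^ (- (n%:R + b)).
pose A k := cube x (2 * r ^+ k).
have c0 k : 0 <= c k by exact: powR_ge0.
have mA k : measurable (A k) by exact: measurable_cube.
have mcA k : measurable_fun setT (fun y => (c k * \1_(A k) y)%:E).
  by apply/measurable_EFinP; exact: measurable_funM.
have cA0 k y : (0 <= (c k * \1_(A k) y)%:E)%E by rewrite lee_fin mulr_ge0.
apply: (@le_trans _ _
  (\int[lebesgueRn R n]_y \sum_(0 <= k <oo) (c k * \1_(A k) y)%:E)%E).
  apply: ge0_le_integral => //.
  - by move=> y _; rewrite lee_fin.
  - exact/measurable_EFinP.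
  - by apply: ge0_emeasurable_sum => // k y _ _; exact: cA0.
  move=> y _; have [->|/Fle[Fy [k /andP[rk kr]]]] := eqVneq (F y) 0.
    by apply: nneseries_ge0 => k _ _; exact: cA0.
  apply: le_trans (ge0_nneseries_ge (fun k => (c k * \1_(A k) y)%:E) k _) => [|i];
    last exact: cA0.
  rewrite lee_fin indicE mem_set ?mulr1; last first.
    by move=> i; apply: le_trans kr; exact: le_tnth_Rdist.
  apply: (le_trans Fy); rewrite /c !powRN lef_pV2 ?posrE ?powR_gt0 ?exprn_gt0//.
    by apply: ge0_ler_powR => //; rewrite nnegrE ?Rdist_ge0// exprn_ge0// ltW.
  by rewrite (lt_le_trans _ rk)// exprn_gt0.
rewrite integral_nneseries//.
rewrite -nneseries_geometric ?exprn_ge0 ?powR_ge0//.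
apply: lee_nneseries => [k _ _|k _]; first by apply: integral_ge0 => y _; exact: cA0.
under eq_integral do rewrite EFinM.
rewrite ge0_integralZl//; last 2 first.
  by apply/measurable_EFinP; exact: measurable_indic.
  by rewrite lee_fin.
rewrite integral_indic// setIT.
rewrite [X in (_ * X)%E](_ : _ = ((2 * (2 * r ^+ k)) ^+ n)%:E); last first.
  by apply: lebesgueRn_cube; rewrite mulr_gt0 ?exprn_gt0.
rewrite -EFinM lee_fin.
rewrite /c (_ : 2 * (2 * _) = 4 * r ^+ k); last ring.
rewrite exprMn mulrCA; apply: ler_wpM2l; first exact: exprn_ge0.
have rk0 : 0 < r ^+ k by exact: exprn_gt0.
rewrite -[(r ^+ k) ^+ n]powR_mulrn; last exact: ltW.
rewrite -powRD; last by rewrite (gt_eqF rk0) implybT.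
rewrite [- _ + _](_ : _ = - b); last by ring.
rewrite -powR_mulrn; last exact: ltW.
by rewrite -powRrM mulrC powRrM powR_mulrn ?powR_ge0.
Qed.

End radial.

(** * Schur's test *)

Section schur.
Context d (T : measurableType d) (R : realType)
  (mu : {sigma_finite_measure set T -> \bar R}).
Local Open Scope ereal_scope.

Lemma cauchy_schwarz_integral (f g : T -> R) :
    measurable_fun setT f -> measurable_fun setT g ->
  (\int[mu]_x `|(f x * g x)%:E|) ^+ 2 <=
  (\int[mu]_x (f x ^+ 2)%:E) * (\int[mu]_x (g x ^+ 2)%:E).
Proof.
move=> mf mg.
have sqrN (h : T -> R) : ('N[mu]_2%:E[EFin \o h]) ^+ 2 = \int[mu]_x (h x ^+ 2)%:E.
  have -> : \int[mu]_x (h x ^+ 2)%:E = \int[mu]_x `|(EFin \o h) x| `^ 2.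
    apply: eq_integral => x _ /=.
    by rewrite powR_mulrn ?normr_ge0// real_normK// num_real.
  rewrite Lnorm.unlock poweR12_sqrt ?sqr_sqrte// integral_ge0// => x _;
    exact: poweR_ge0.
rewrite -!sqrN !expe2 muleACA -!expe2 lee_sqr//.
- by rewrite -(Lnorm1 mu); apply: hoelder => //; lra.
- by apply: integral_ge0.
by rewrite mule_ge0// Lnorm_ge0.
Qed.

(** Writing [k * g] as [sqrt k * (sqrt k * g)], the Cauchy-Schwarz inequality
    bounds the square of the inner integral by [M] times the integral of
    [k * g ^ 2] in [y]; integrating in [x] first gives the other factor [M]. *)
Lemma schur_test (k : T -> T -> R) (M : R) (g : T -> R) :
    measurable_fun setT (fun p => k p.1 p.2) -> (forall x y, (0 <= k x y)%R) ->
    (forall x, \int[mu]_y (k x y)%:E <= M%:E) ->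
    (forall y, \int[mu]_x (k x y)%:E <= M%:E) ->
    measurable_fun setT g -> (forall y, (0 <= g y)%R) ->
  \int[mu]_x (\int[mu]_y (k x y * g y)%:E) ^+ 2 <=
  (M ^+ 2)%:E * \int[mu]_y (g y ^+ 2)%:E.
Proof.
move=> mk k0 kM1 kM2 mg g0.
have mkx x : measurable_fun setT (k x).
  exact: (measurableT_comp mk (pair1_measurable x)).
have mky y : measurable_fun setT (k ^~ y).
  exact: (measurableT_comp mk (pair2_measurable y)).
have msqrt := @measurable_sqrt R.
have mg2 : measurable_fun setT (fun p : T * T => g p.2).
  by apply: measurableT_comp => //; exact: measurable_snd.
pose F (p : T * T) := (k p.1 p.2 * g p.2 ^+ 2)%:E.
have mF : measurable_fun setT F.
  by apply/measurable_EFinP; apply: measurable_funM => //; exact: measurable_funX.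
have F0 p : 0 <= F p by rewrite lee_fin mulr_ge0// sqr_ge0.
have [->|/set0P[x0 _]] := eqVneq [set: T] set0.
  by rewrite !integral_set0 mule0.
have M0 : (0 <= M)%R.
  rewrite -lee_fin (le_trans _ (kM1 x0))// integral_ge0// => y _.
  by rewrite lee_fin.
have mG : measurable_fun setT (fun x => \int[mu]_y F (x, y)).
  exact: measurable_fun_fubini_tonelli_F.
apply: (@le_trans _ _ (\int[mu]_x (M%:E * \int[mu]_y F (x, y)))).
  apply: ge0_le_integral => //.
  - by move=> x _; exact: sqre_ge0.
  - under eq_fun do rewrite expe2.
    have mH : measurable_fun setT (fun x => \int[mu]_y (k x y * g y)%:E).
      apply: (measurable_fun_fubini_tonelli_F (fun p => (k p.1 p.2 * g p.2)%:E)).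
        by apply/measurable_EFinP; exact: measurable_funM.
      by move=> p; rewrite lee_fin mulr_ge0.
    exact: emeasurable_funM.
  - exact: emeasurable_funM.
  move=> x _.
  have h := cauchy_schwarz_integral (fun y => Num.sqrt (k x y))
    (fun y => Num.sqrt (k x y) * g y)%R (measurableT_comp msqrt (mkx x))
    (measurable_funM (measurableT_comp msqrt (mkx x)) mg).
  rewrite (_ : \int[mu]_y (k x y * g y)%:E =
      \int[mu]_y `|(Num.sqrt (k x y) * (Num.sqrt (k x y) * g y))%:E|); last first.
    apply: eq_integral => y _.
    by rewrite mulrA -expr2 sqr_sqrtr// gee0_abs// lee_fin mulr_ge0.
  apply: (le_trans h); apply: lee_pmul.
  - by apply: integral_ge0 => y _; rewrite lee_fin sqr_ge0.
  - by apply: integral_ge0 => y _; rewrite lee_fin sqr_ge0.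
  - by under eq_integral do rewrite sqr_sqrtr//.
  - by under eq_integral do rewrite exprMn sqr_sqrtr//.
rewrite ge0_integralZl//; last by move=> x _; exact: integral_ge0.
rewrite fubini_tonelli// expr2 EFinM -muleA; apply: lee_wpmul2l => //.
rewrite -ge0_integralZl//; last 2 first.
- by apply/measurable_EFinP; exact: measurable_funX.
- by move=> y _; rewrite lee_fin sqr_ge0.
apply: ge0_le_integral => //.
- by move=> y _; exact: integral_ge0.
- exact: measurable_fun_fubini_tonelli_G.
- by apply: emeasurable_funM => //; apply/measurable_EFinP; exact: measurable_funX.
move=> y _; rewrite /F/=.
under eq_integral do rewrite EFinM muleC.
rewrite ge0_integralZl//.
- by rewrite muleC lee_wpmul2r// lee_fin sqr_ge0.
- exact/measurable_EFinP.
- by move=> x _; rewrite lee_fin.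
by rewrite lee_fin sqr_ge0.
Qed.

End schur.

(** * The radial majorant of the conjugated kernel *)

Section majorant.
Context {R : realType}.

Lemma powR_lt1 (a x : R) : 0 < a -> x * ln a < 0 -> a `^ x < 1.
Proof. by move=> a0 h; rewrite /powR gt_eqF// expR_lt1. Qed.

Definition majorant (n : nat) (s lam d : R) : R :=
  dist_modulus lam d / d `^ (n%:R + s).

Lemma majorant_ge0 n s lam d : 0 <= d -> 0 <= majorant n s lam d.
Proof.
move=> d0; rewrite /majorant divr_ge0 ?powR_ge0// /dist_modulus.
by case: ifP => _; rewrite mulr_ge0// powR_ge0.
Qed.

Lemma measurable_majorant n s lam : measurable_fun setT (majorant n s lam).
Proof.
apply: measurable_funM.
  apply: measurable_fun_ifT.
  - exact: measurable_fun_ler.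
  - exact: measurable_funM.
  - by apply: measurable_funM => //; exact: measurable_powR.
under eq_fun do rewrite -powRN.
exact: measurable_powR.
Qed.

(** The majorant is [2 d ^ - (n + (s - 1))] for [d <= 1] and
    [2 d ^ - (n + (s - lam / 2))] for [d > 1]; the first exponent is summed over
    annuli of ratio [1 / 2], the second over annuli of ratio 2. *)
Lemma integral_majorant_le n s lam : (0 < n)%N -> 0 < s < 1 -> lam < 2 * s ->
  exists M : R, forall x : Rn R n,
    (\int[lebesgueRn R n]_y (majorant n s lam (Rdist x y))%:E <= M%:E)%E.
Proof.
move=> n0 /andP[s0 s1] lams.
have n1 : 1 <= n%:R :> R by rewrite ler1n.
pose F1 (x y : Rn R n) :=
  (if Rdist x y <= 1 then majorant n s lam (Rdist x y) / 2 else 0).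
pose F2 (x y : Rn R n) :=
  (if Rdist x y <= 1 then 0 else majorant n s lam (Rdist x y) / 2).
pose q1 : R := (2^-1) `^ (- (s - 1)); pose q2 : R := 2 `^ (- (s - lam / 2)).
exists (2 * (4 ^+ n / (1 - q1) + 4 ^+ n / (1 - q2))) => x.
have mmaj : measurable_fun setT (fun y => majorant n s lam (Rdist x y) / 2).
  apply: measurable_funM => //.
  by apply: measurableT_comp; [exact: measurable_majorant|exact: measurable_Rdist].
have mle : measurable_fun setT (fun y => Rdist x y <= 1).
  by apply: measurable_fun_ler => //; exact: measurable_Rdist.
have mF1 : measurable_fun setT (F1 x) by exact: measurable_fun_ifT.
have mF2 : measurable_fun setT (F2 x) by exact: measurable_fun_ifT.
have maj0 y : 0 <= majorant n s lam (Rdist x y) / 2.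
  by rewrite divr_ge0// majorant_ge0// Rdist_ge0.
have F10 y : 0 <= F1 x y by rewrite /F1; case: ifP.
have F20 y : 0 <= F2 x y by rewrite /F2; case: ifP.
rewrite (eq_integral (fun y => 2%:E * ((F1 x y)%:E + (F2 x y)%:E))%E); last first.
  move=> y _; rewrite -EFinD -EFinM /F1 /F2.
  by case: ifP => _; rewrite ?addr0 ?add0r mulrC divfK.
have F1_near (y : Rn R n) : F1 x y != 0 -> 0 < Rdist x y <= 1.
  rewrite /F1; case: ifPn => [_|]; rewrite ?eqxx// andbT.
  apply: contraR; rewrite -leNgt => dle0.
  have -> : Rdist x y = 0 by apply/eqP; rewrite eq_le dle0 Rdist_ge0.
  by rewrite /majorant /dist_modulus ler01 mulr0 !mul0r.
have F2_far (y : Rn R n) : F2 x y != 0 -> 1 < Rdist x y.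
  by rewrite /F2; case: ifPn; rewrite ?eqxx// -ltNge.
have cancel2 (a b : R) : 2 * a * b / 2 = a * b by field.
have int0 (F : Rn R n -> R) : (forall y, 0 <= F y) ->
    forall y, setT y -> (0 <= (F y)%:E)%E by move=> F0 y _; rewrite lee_fin.
rewrite ge0_integralZl//; last 2 first.
- by apply: emeasurable_funD; exact/measurable_EFinP.
- by move=> y _; rewrite adde_ge0// lee_fin.
rewrite ge0_integralD//; try exact: int0; try exact/measurable_EFinP.
rewrite [leRHS]EFinM; apply: lee_wpmul2l => //; rewrite [leRHS]EFinD; apply: leeD.
  apply: integral_annuli_le => //; first lra.
    apply: powR_lt1; rewrite ?invr_gt0// pmulr_rlt0; last lra.
    by apply: ln_lt0; lra.
  move=> y Fy; have /andP[d0 d1] := F1_near y Fy.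
  split; last exact/dyadic_le1/F1_near.
  rewrite /F1 d1 /majorant /dist_modulus d1 -powRN.
  rewrite cancel2 -{1}[Rdist x y]powRr1 ?Rdist_ge0// -powRD;
    last by rewrite (gt_eqF d0) implybT.
  by rewrite le_eqVlt; apply/orP; left; apply/eqP; congr powR; ring.
apply: integral_annuli_le => //; first lra.
  apply: powR_lt1; rewrite // pmulr_llt0; first lra.
  by apply: ln_gt0; lra.
move=> y Fy; have d1 := F2_far y Fy.
split; last by apply: dyadic_ge1; exact: (ltW d1).
have nd1 : (Rdist x y <= 1) = false by apply/negbTE; rewrite -ltNge; exact: d1.
rewrite /F2 /majorant /dist_modulus nd1 -powRN.
have d0 : 0 < Rdist x y by exact: lt_trans ltr01 d1.
rewrite cancel2 -powRD; last by rewrite (gt_eqF d0) implybT.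
by rewrite le_eqVlt; apply/orP; left; apply/eqP; congr powR; ring.
Qed.

End majorant.

(** * Principal values of integrable kernels *)

Section principal_value.
Context {R : realType} {n : nat}.
Notation mu := (lebesgueRn R n).
Implicit Types x y : Rn R n.

Lemma measurable_far x (e : R) : measurable (far x e).
Proof.
rewrite (_ : far x e = Rdist x @^-1` `]e, +oo[).
  by rewrite -[X in measurable X]setTI; exact: measurable_Rdist.
by apply/seteqP; split => y /=; rewrite in_itv/= andbT.
Qed.

(** The complements of balls of radius [e] fill up everything but the point [x]
    as [e] goes to 0. By [K x = 0] the truncated kernels converge at [x]
    as well, so dominated convergence applies with pointwise convergence. *)
Lemma pv_integrable (K : Rn R n -> R) x :
    mu.-integrable setT (EFin \o K) -> K x = 0 ->
  pv_exists K x /\ pv K x = \int[mu]_y K y.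
Proof.
move=> iK Kx0.
have mK : measurable_fun setT (EFin \o K) by exact: measurable_int iK.
have cvK : pv_trunc K x e @[e --> 0^'+] --> \int[mu]_y K y.
  apply/cvg_at_rightP => u [u0 ucv].
  apply: fine_cvg; rewrite fineK; last exact: integrable_fin_num iK.
  under eq_fun do rewrite integral_mkcond.
  apply: (@dominated_cvg _ _ _ mu setT measurableT _ (EFin \o K) (abse \o (EFin \o K))).
  - move=> m; apply/(measurable_restrict _ _ _) => //.
      exact: measurable_far.
    by rewrite setTI; exact: measurable_funS mK.
  - move=> y _ /=; have [d0|d0] := eqVneq (Rdist x y) 0.
      rewrite -(Rdist_eq0 _ _ d0) Kx0.
      rewrite (_ : (fun m => _) = cst 0%E); first exact: cvg_cst.
      by apply/funext => m; rewrite /patch; case: ifP => //=; rewrite Kx0.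
    apply: cvg_near_cst; near=> m.
    rewrite patchT// inE /far/=.
    near: m; apply: (cvgr_lt 0) => //.
    by rewrite lt0r d0 Rdist_ge0.
  - by move=> y _ /=.
  - exact: integrable_abse.
  - by move=> m y _; rewrite /patch; case: ifP => // _; rewrite abse0 abse_ge0.
split; last exact: cvg_lim.
split; last by apply/cvg_ex; exists (\int[mu]_y K y).
move=> e _; have /integrableP[_] := iK; apply: le_lt_trans.
apply: ge0_subset_integral => //; first exact: measurable_far.
exact: measurableT_comp.
Unshelve. all: by end_near.
Qed.

End principal_value.

(** * Boundedness of commutators with a Schur majorant *)

Section bounded.
Context {R : realType} {n : nat}.
Notation mu := (lebesgueRn R n).
Implicit Types (x y : Rn R n) (w f g : Rn R n -> R).

Lemma commutator_ae (s : R) w f g x :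
    {ae mu, forall y, f y = g y} ->
  (commutator_exists s w f x <-> commutator_exists s w g x) /\
  commutator s w f x = commutator s w g x.
Proof.
move=> fg.
have truncE : pv_trunc (commutator_kernel s w f x) x =
              pv_trunc (commutator_kernel s w g x) x.
  apply/funext => e; rewrite /pv_trunc /Rintegral; congr fine.
  apply: ae_integral; apply: filterS fg => y fgy _.
  by rewrite /commutator_kernel fgy.
have absE e : (\int[mu]_(y in far x e) `|(commutator_kernel s w f x y)%:E| =
               \int[mu]_(y in far x e) `|(commutator_kernel s w g x y)%:E|)%E.
  apply: ae_integral; apply: filterS fg => y fgy _.
  by rewrite /commutator_kernel fgy.
rewrite /commutator /commutator_exists /pv_exists /pv truncE; split => //.
by split => -[h1 h2]; split => // e e0; have := h1 e e0; rewrite absE.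
Qed.

Lemma le_abs_fine (a : \bar R) : ((`|fine a|)%:E <= `|a|)%E.
Proof. by case: a => [r| |] //=; rewrite normr0 leey. Qed.

(** Let [H] be the integral operator with kernel [k] applied to [sqrt w * |f|].
    Then the absolute integral defining the commutator at [x] is at most
    [sqrt (w x) * H x]. By Schur's test, [H] is square integrable, hence finite
    almost everywhere; where it is finite, the principal value exists and is the
    integral of the whole kernel. Dividing by [sqrt (w x)], the
    factor that [1 / w] contributes to the norm, leaves [H x] up to a constant. *)
Lemma commutator_L2_bounded (s M : R) w (k : Rn R n -> Rn R n -> R) :
    measurable_fun setT w -> (forall x, 0 < w x) ->
    measurable_fun setT (fun p => k p.1 p.2) -> (forall x y, 0 <= k x y) ->
    (forall x, (\int[mu]_y (k x y)%:E <= M%:E)%E) ->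
    (forall y, (\int[mu]_x (k x y)%:E <= M%:E)%E) ->
    (forall x y, `|(w x - w y) / Rdist x y `^ (n%:R + s)| <=
       Num.sqrt (w x) * (k x y * Num.sqrt (w y))) ->
  L2_bounded (commutator_exists s w) (commutator s w) w (fun x => (w x)^-1).
Proof.
move=> mw w0 mk k0 kM1 kM2 wk.
pose c := @frac_const R n s.
(* The summand 1 only makes the constant positive. *)
exists (c ^+ 2 * M ^+ 2 + 1); first by rewrite ltr_wpDl// mulr_ge0// sqr_ge0.
(* [g] is a Borel representative of [f]; all integrals below are taken with it. *)
move=> f [[g mg fg] fL2].
have msqrtw : measurable_fun setT (fun y => Num.sqrt (w y)).
  exact: (measurableT_comp measurable_sqrt mw).
pose h y := Num.sqrt (w y) * `|g y|.
have h0 y : 0 <= h y by rewrite mulr_ge0// sqrtr_ge0.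
have mh : measurable_fun setT h.
  by apply: measurable_funM => //; exact: measurableT_comp.
have hL2 : (\int[mu]_y (h y ^+ 2)%:E)%E = L2sqnorm w f.
  apply: ae_integral; apply: filterS fg => y -> _.
  by rewrite /h exprMn sqr_sqrtr ?ltW// mulrC.
pose H x := (\int[mu]_y (k x y * h y)%:E)%E.
have kh0 x y : (0 <= (k x y * h y)%:E)%E by rewrite lee_fin mulr_ge0.
have H0 x : (0 <= H x)%E by exact: integral_ge0.
have mh2 : measurable_fun setT (fun p : Rn R n * Rn R n => h p.2).
  by apply: measurableT_comp => //; exact: measurable_snd.
have mH : measurable_fun setT H.
  apply: (measurable_fun_fubini_tonelli_F (fun p => (k p.1 p.2 * h p.2)%:E)) => //.
  by apply/measurable_EFinP; exact: measurable_funM.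
have mH2 : measurable_fun setT (fun x => (H x ^+ 2)%E).
  by under eq_fun do rewrite expe2; exact: emeasurable_funM.
have HL2 : (\int[mu]_x (H x ^+ 2) <= (M ^+ 2)%:E * L2sqnorm w f)%E.
  by rewrite -hL2; exact: schur_test.
have Hfin : {ae mu, forall x, (H x < +oo)%E}.
  have iH2 : mu.-integrable setT (fun x => H x ^+ 2)%E.
    apply/integrableP; split => //.
    under eq_integral do rewrite gee0_abs ?sqre_ge0//.
    by rewrite (le_lt_trans HL2)// lte_mul_pinfty ?lee_fin ?sqr_ge0.
  apply: filterS (integrable_ae measurableT iH2) => x /(_ I).
  rewrite ltey; apply: contraTneq => ->.
  by rewrite expe2 mulyy.
pose K x y := commutator_kernel s w g x y.
have mK : measurable_fun setT (fun p : Rn R n * Rn R n => K p.1 p.2).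
  rewrite /K /commutator_kernel.
  apply: measurable_funM; last first.
    by apply: measurableT_comp => //; exact: measurable_snd.
  apply: measurable_funM.
    by apply: measurable_funB; apply: (measurableT_comp mw);
      [exact: measurable_fst|exact: measurable_snd].
  under eq_fun do rewrite -powRN.
  apply: (@measurableT_comp _ _ _ _ _ _ (fun r : R => r `^ (- (n%:R + s))) _
    (fun p : Rn R n * Rn R n => Rdist p.1 p.2)); first exact: measurable_powR.
  exact: measurable_Rdist2.
have mKx x : measurable_fun setT (K x).
  exact: (measurableT_comp mK (pair1_measurable x)).
have mkhx x : measurable_fun setT (fun y => k x y * h y).
  by apply: measurable_funM => //; exact: (measurableT_comp mk (pair1_measurable x)).
have Kle x y : `|K x y| <= Num.sqrt (w x) * (k x y * h y).
  rewrite /K /commutator_kernel normrM /h [k x y * _]mulrA mulrA.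
  by apply: ler_wpM2r.
have intKle x : (\int[mu]_y `|(K x y)%:E| <= (Num.sqrt (w x))%:E * H x)%E.
  rewrite -ge0_integralZl//; last exact/measurable_EFinP.
  apply: ge0_le_integral => //.
  - by apply: measurableT_comp => //; exact/measurable_EFinP.
  - by apply: emeasurable_funM => //; exact/measurable_EFinP.
  - by move=> y _; rewrite -EFinM lee_fin.
have iK x : (H x < +oo)%E -> mu.-integrable setT (EFin \o K x).
  move=> Hx; apply/integrableP; split; first exact/measurable_EFinP.
  by rewrite (le_lt_trans (intKle x))// lte_mul_pinfty// lee_fin sqrtr_ge0.
(* Where the integral is infinite, [fine] returns 0: this is what lets [S] be
   defined, measurable and bounded by [sqrt (w x) * H x] at every point. *)
pose S x := c * fine (\int[mu]_y (K x y)%:E).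
have mS : measurable_fun setT S.
  apply: measurable_funM => //.
  apply: (@measurableT_comp _ _ _ _ _ _ fine); first exact: fine_measurable.
  pose P (p : Rn R n * Rn R n) := (K p.1 p.2)%:E.
  have mP : measurable_fun setT P by exact/measurable_EFinP.
  rewrite (_ : (fun x => _) = (fun x => (\int[mu]_y (P^\+) (x, y))
      - (\int[mu]_y (P^\-) (x, y)))%E); last first.
    apply/funext => x; rewrite integralE; congr (_ - _)%E.
      by apply: eq_integral => y _; rewrite !funeposE.
    by apply: eq_integral => y _; rewrite !funenegE.
  apply: emeasurable_funB.
  - by apply: measurable_fun_fubini_tonelli_F => //; exact: measurable_funepos.
  - by apply: measurable_fun_fubini_tonelli_F => //; exact: measurable_funeneg.
have pvK x : (H x < +oo)%E ->
    commutator_exists s w f x /\ commutator s w f x = S x.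
  move=> Hx; have [e ->] := commutator_ae s w f g x fg.
  have Kxx : K x x = 0 by rewrite /K /commutator_kernel subrr !mul0r.
  have [ex E] := pv_integrable (K x) x (iK x Hx) Kxx.
  split; first by apply/e; exact: ex.
  by rewrite /commutator E.
have SL2 : (L2sqnorm (fun x => (w x)^-1)%R S <=
    (c ^+ 2 * M ^+ 2)%:E * L2sqnorm w f)%E.
  rewrite EFinM -muleA.
  apply: (@le_trans _ _ (\int[mu]_x ((c ^+ 2)%:E * H x ^+ 2))%E); last first.
    rewrite ge0_integralZl//.
    - by apply: lee_wpmul2l => //; rewrite lee_fin sqr_ge0.
    - by move=> x _; exact: sqre_ge0.
    - by rewrite lee_fin sqr_ge0.
  apply: ge0_le_integral => //.
  - by move=> x _; rewrite lee_fin mulr_ge0 ?sqr_ge0// invr_ge0 ltW.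
  - apply/measurable_EFinP; apply: measurable_funM.
      by apply: measurable_funX; exact: measurableT_comp.
    under eq_fun => x do rewrite -powR_inv1 ?ltW//.
    apply: (@measurableT_comp _ _ _ _ _ _ (fun r : R => r `^ -1) _ w) => //.
  - by apply: emeasurable_funM.
  move=> x _; set r := Num.sqrt (w x).
  have r0 : 0 < r by rewrite sqrtr_gt0.
  have rIH : ((r^-1 * `|S x|)%:E <= `|c|%:E * H x)%E.
    rewrite /S normrM mulrCA EFinM; apply: lee_wpmul2l; first by rewrite lee_fin.
    have -> : H x = (r^-1%:E * (r%:E * H x))%E.
      by rewrite muleA -EFinM mulVf ?mul1e// gt_eqF.
    rewrite EFinM; apply: lee_wpmul2l; first by rewrite lee_fin invr_ge0 ltW.
    apply: (le_trans (le_abs_fine _)); apply: le_trans (intKle x).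
    by apply: le_abse_integral => //; exact/measurable_EFinP.
  have -> : (`|S x| ^+ 2 * (w x)^-1)%:E = ((r^-1 * `|S x|)%:E ^+ 2)%E.
    by rewrite -EFin_expe exprMn exprVn sqr_sqrtr ?ltW// mulrC.
  have -> : ((c ^+ 2)%:E * H x ^+ 2 = (`|c|%:E * H x) ^+ 2)%E.
    by rewrite [RHS]expe2 muleACA -EFinM -expr2 real_normK ?num_real// expe2.
  rewrite lee_sqr//.
    by rewrite lee_fin mulr_ge0// invr_ge0 ltW.
  by rewrite mule_ge0.
have TS : {ae mu, forall x, commutator s w f x = S x}.
  by apply: filterS Hfin => x /pvK[].
have TL2 : (L2sqnorm (fun x => (w x)^-1)%R (commutator s w f) <=
    (c ^+ 2 * M ^+ 2)%:E * L2sqnorm w f)%E.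
  apply: le_trans SL2; rewrite le_eqVlt; apply/orP; left; apply/eqP.
  by apply: ae_integral; apply: filterS TS => x -> _.
split.
- by apply: filterS Hfin => x /pvK[].
- split; first by exists S.
  by rewrite (le_lt_trans TL2)// lte_mul_pinfty// lee_fin mulr_ge0// sqr_ge0.
apply: (le_trans TL2); apply: lee_wpmul2r; last by rewrite lee_fin lerDl.
by apply: integral_ge0 => x _; rewrite lee_fin mulr_ge0 ?sqr_ge0// ltW.
Qed.

End bounded.

(** * Commutators with slowly varying weights *)

Section conclusion.
Context {R : realType} {n : nat}.

Lemma slowly_varying_commutator_bounded (s lam : R) (w : Rn R n -> R) :
    (0 < n)%N -> 0 < s < 1 -> 0 <= lam < 2 * s ->
    measurable_fun setT w -> (forall x, 0 < w x) ->
    (forall x y, w x <= (1 + Rdist x y) `^ lam * w y) ->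
  L2_bounded (commutator_exists s w) (commutator s w) w (fun x => (w x)^-1).
Proof.
move=> n0 s01 /andP[lam0 lams] mw w0 wslow.
have [M hM] := integral_majorant_le n s lam n0 s01 lams.
have lam02 : 0 <= lam <= 2 by move: s01 => /andP[s0 s1]; rewrite lam0/=; lra.
pose k (x y : Rn R n) := majorant n s lam (Rdist x y).
have mk : measurable_fun setT (fun p => k p.1 p.2).
  apply: (@measurableT_comp _ _ _ _ _ _ (majorant n s lam) _
    (fun p : Rn R n * Rn R n => Rdist p.1 p.2)); first exact: measurable_majorant.
  exact: measurable_Rdist2.
have k0 x y : 0 <= k x y by apply: majorant_ge0; exact: Rdist_ge0.
have kM y : (\int[lebesgueRn R n]_x (k x y)%:E <= M%:E)%E.
  rewrite (eq_integral (fun x => (k y x)%:E)); first exact: hM.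
  by move=> x _; rewrite /k RdistC.
apply: (commutator_L2_bounded s M w k mw w0 mk k0 hM kM) => x y.
rewrite normrM normfV (ger0_norm (powR_ge0 _ _)) /k /majorant.
rewrite [leRHS](_ : _ = Num.sqrt (w x) * Num.sqrt (w y) *
  dist_modulus lam (Rdist x y) / Rdist x y `^ (n%:R + s)); last by ring.
apply: ler_wpM2r; first by rewrite invr_ge0 powR_ge0.
exact: slowly_varying_diff_le lam02 w0 wslow x y.
Qed.

Lemma weight_commutator_bounded (s lam : R) (k : nat) :
    (0 < n)%N -> (0 < k)%N -> 0 < s < 1 -> 0 <= lam < 2 * s ->
  let w : Rn R n -> R := weight lam k in
  L2_bounded (commutator_exists s w) (commutator s w) w (fun x => (w x)^-1).
Proof.
move=> n0 k0 s01 lams w; have /andP[lam0 _] := lams.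
apply: (slowly_varying_commutator_bounded s lam w n0 s01 lams).
- exact: measurable_weight.
- by move=> x; exact: weight_gt0.
- by move=> x y; exact: weight_ratio.
Qed.

End conclusion.

Theorem lemma4p1 (R : realType) (n : nat) (hn : (1 <= n)%N) (alpha : R) :
  (0 < alpha < 1 ->
   forall (lambda : R) (kappa : nat),
     0 < lambda < alpha / 2 -> (2 <= kappa)%N -> ~~ odd kappa ->
     let w : Rn R n -> R := weight lambda kappa in
     L2_bounded (commutator_exists (alpha / 2) w) (commutator (alpha / 2) w)
       w (fun x => (w x)^-1))
  /\
  (1 < alpha < 2 ->
   forall (lambda : R) (kappa : nat),
     0 < lambda < 1 -> (2 <= kappa)%N -> ~~ odd kappa ->
     let w : Rn R n -> R := weight lambda kappa in
     L2_bounded (commutator_exists (alpha / 2) w) (commutator (alpha / 2) w)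
       w (fun x => (w x)^-1)).
Proof.
split=> /andP[a0 a1] lam k /andP[l0 l1] k2 _; apply: weight_commutator_bounded => //.
all: by [rewrite (leq_trans _ k2)|apply/andP; split; lra].
Qed.
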